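(* In the stochastic opinion dynamics described below, almost surely the vector $\beta(t)$ converges as $t\to\infty$ to a point $\beta^*\in[0,1]^n$ with $F(\beta^* )=\beta^*$.
   Context: Let $A=(a_{i,j})$ be a symmetric $n\times n$ matrix with nonnegative entries, the weighted adjacency matrix of an undirected graph $G$ on $\{1,\dots,n\}$ (self-loops allowed) that is connected and not bipartite; let $\deg(i)=\sum_j a_{i,j}$. Each agent $i$ has a bias parameter $\gamma_i>0$, and $\mathrm{diag}(\gamma_1,\dots,\gamma_n)\neq I$. Define $f(\mu,\gamma)=\frac{\gamma\mu}{1+(\gamma-1)\mu}$ for $\mu\in[0,1]$, and for $\beta\in[0,1]^n$ let $\mu_i(\beta)=\frac{1}{\deg(i)}\sum_j a_{i,j}\beta_j$ and $F_i(\beta)=f(\mu_i(\beta),\gamma_i)$. Dynamics: $\beta_i(1)\in(0,1)$ are given initial values. For each $t\ge1$, conditionally on the history $\mathcal{H}_t$ (all declarations up to time $t$), the declarations $\psi_{i,t+1}\in\{0,1\}$, $i=1,\dots,n$, are independent with $\mathbb{P}[\psi_{i,t+1}=1\mid\mathcal{H}_t]=f(\mu_i(\beta(t)),\gamma_i)$, and $\beta_i(t+1)=\frac{t}{t+1}\beta_i(t)+\frac{1}{t+1}\psi_{i,t+1}$. *)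

(* Defs.v *)
From HB Require Import structures.
From mathcomp Require Import all_boot all_order all_algebra.
From mathcomp Require Import all_classical all_reals all_analysis.
Set Implicit Arguments. Unset Strict Implicit. Unset Printing Implicit Defensive.
Import Order.TTheory GRing.Theory Num.Theory.
Import numFieldNormedType.Exports.
Local Open Scope classical_set_scope.
Local Open Scope ring_scope.

Section Defs.
Variables (R : realType) (n : nat).

Definition edge (A : 'M[R]_n) : rel 'I_n := fun i j => 0 < A i j.

Definition symmetric_nonneg (A : 'M[R]_n) : Prop :=
  forall i j, A i j = A j i /\ 0 <= A i j.

Definition graph_connected (A : 'M[R]_n) : Prop :=
  forall i j, connect (edge A) i j.

Definition graph_bipartite (A : 'M[R]_n) : Prop :=
  exists c : 'I_n -> bool, forall i j, edge A i j -> c i != c j.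

Definition deg (A : 'M[R]_n) (i : 'I_n) : R := \sum_j A i j.

Definition fbias (mu g : R) : R := g * mu / (1 + (g - 1) * mu).

Definition mu (A : 'M[R]_n) (b : 'I_n -> R) (i : 'I_n) : R :=
  (deg A i)^-1 * \sum_j A i j * b j.

Definition Fmap (A : 'M[R]_n) (g : 'I_n -> R) (b : 'I_n -> R) (i : 'I_n) : R :=
  fbias (mu A b i) (g i).

(* betaS b1 d k = beta(k+1), computed from initial opinions b1 and
   declarations d t i (meaningful for times t >= 2):
   beta(t+1) = t/(t+1) beta(t) + 1/(t+1) psi_{t+1}. *)
Fixpoint betaS (b1 : 'I_n -> R) (d : nat -> 'I_n -> bool) (k : nat) : 'I_n -> R :=
  match k with
  | 0 => b1
  | k'.+1 => fun i => (k'.+1%:R / k'.+2%:R) * betaS b1 d k' i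
                      + (d k'.+2 i)%:R / k'.+2%:R
  end.

(* beta(t) for t >= 1 *)
Definition beta (b1 : 'I_n -> R) (d : nat -> 'I_n -> bool) (t : nat) : 'I_n -> R :=
  betaS b1 d t.-1.

End Defs.

(* Main.v *)
(* The symmetric weights make the mean-field flow b' = F b - b increase the
   function V b = b^T A b / 2 - sum_i deg i * G_i (b_i), where G_i is a primitive
   of the inverse of mu |-> fbias mu (gam i): indeed dV/dt is a sum of products
   deg i * (mu_i - finv b_i) * (F_i b - b_i) of terms of equal sign.  Taking
   expectations of V (beta t), whose increments have second order error O(1/t^2),
   gives sum_t E [(F_i (beta t) - beta_i t)^2] / t < oo, and since beta moves by
   at most 1/t at time t this forces F (beta t) - beta t --> 0 almost surely;
   no convergence theorem for martingales is needed.

   A fixed point with a coordinate 0 (or 1) is constant, by connectedness.  In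
   odds coordinates F is nonexpansive for the sup metric, and the equality case
   of concavity shows that two distinct fixed points with coordinates in ]0, 1[
   would force either a 2-colouring of the graph or gam = 1.  So there are at
   most three fixed points; beta approaches this finite set with steps tending
   to 0, hence it converges to one of them. *)
Require Import Defs.
From HB Require Import structures.
From mathcomp Require Import all_boot all_order all_algebra.
From mathcomp Require Import all_classical all_reals all_analysis.
From mathcomp Require Import ring lra.
Set Implicit Arguments. Unset Strict Implicit. Unset Printing Implicit Defensive.
Import Order.TTheory GRing.Theory Num.Theory.
Import numFieldNormedType.Exports.
Local Open Scope classical_set_scope.
Local Open Scope ring_scope.

(** * Fixed points on the network *)

Section Network.
Variables (R : realType) (n : nat) (A : 'M[R]_n) (g : 'I_n -> R).
Hypotheses (symA : symmetric_nonneg A) (g_gt0 : forall i, 0 < g i).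

Lemma weight_ge0 i j : 0 <= A i j.
Proof. by case: (symA i j). Qed.

Lemma edge_sym i j : edge A i j = edge A j i.
Proof. by rewrite /edge; case: (symA i j) => ->. Qed.

Lemma edge_propagate (Q : 'I_n -> Prop) : graph_connected A ->
  (forall i j, edge A i j -> Q i -> Q j) -> forall i j, Q i -> Q j.
Proof.
move=> conA step i j; case/connectP: (conA i j) => p + ->.
elim: p i => //= k p IH i /andP[eik pk] Qi.
by apply: IH pk _; apply: step Qi.
Qed.

(** By connectedness an isolated vertex would be the only vertex and the graph would have no edge,
    so that a constant colouring would make it bipartite. *)
Lemma deg_gt0 : graph_connected A -> ~ graph_bipartite A ->
  forall i, 0 < deg A i.
Proof.
move=> conA nbip i; rewrite lt0r sumr_ge0 ?andbT; last by move=> j _; exact: weight_ge0.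
apply/eqP => di0; apply: nbip; exists xpredT => k l ekl; exfalso.
have noi j : ~~ edge A i j.
  have /psumr_eq0P/(_ _ _) : deg A i = 0 by [].
  by rewrite /edge => -> //; [rewrite ltxx | move=> ? _; exact: weight_ge0].
have := conA i k; case/connectP => -[/= _ ki|m p /= /andP[eim _] _].
  by move: (noi l); rewrite -ki ekl.
by move: (noi m); rewrite eim.
Qed.

Hypothesis deg_gt0A : forall i, 0 < deg A i.

Definition cube : set ('I_n -> R) := [set b | forall i, 0 <= b i <= 1].

Lemma deg_mu b i : deg A i * mu A b i = \sum_j A i j * b j.
Proof. by rewrite /mu mulrA divff ?mul1r // gt_eqF. Qed.

Lemma muB b c i : mu A b i - mu A c i = mu A (fun j => b j - c j) i.
Proof.
by rewrite /mu -mulrBr -sumrB; congr (_ * _); apply: eq_bigr => j _; rewrite mulrBr.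
Qed.

Lemma mu_const c i : mu A (fun=> c) i = c.
Proof. by rewrite /mu -mulr_suml mulrA mulVf ?mul1r // gt_eqF. Qed.

Lemma mu_le b c i : (forall j, b j <= c j) -> mu A b i <= mu A c i.
Proof.
move=> bc; rewrite /mu ler_pM2l ?invr_gt0 //; apply: ler_sum => j _.
by rewrite ler_wpM2l // weight_ge0.
Qed.

Lemma mu_itv b i : cube b -> 0 <= mu A b i <= 1.
Proof.
move=> cb; have m0 := mu_const 0 i; have m1 := mu_const 1 i.
by apply/andP; split; [rewrite -m0|rewrite -m1]; apply: mu_le => j; case/andP: (cb j).
Qed.

Lemma mu_eq0 b i : (forall j, 0 <= b j) -> mu A b i = 0 ->
  forall j, edge A i j -> b j = 0.
Proof.
move=> b0 m0 j eij; have := deg_mu b i; rewrite m0 mulr0 => /esym/psumr_eq0P.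
move=> /(_ (fun k _ => mulr_ge0 (weight_ge0 i k) (b0 k)) j isT) /eqP.
by rewrite mulf_eq0 gt_eqF //= => /eqP.
Qed.

(** The denominator of [fbias] is the convex combination [(1 - z) + c * z] of 1 and [c]. *)
Lemma fbias_den (z c : R) : 0 < c -> 0 <= z <= 1 -> 0 < 1 + (c - 1) * z <= 1 + c.
Proof.
move=> c0 /andP[z0 z1]; have cz := mulr_ge0 (ltW c0) z0.
have cz' : 0 <= c * (1 - z) by rewrite mulr_ge0 ?subr_ge0 // ltW.
apply/andP; split; last by lra.
have [zlt|zge] := ltrP z 1; first by lra.
have -> : z = 1 by lra.
lra.
Qed.

(* Numerator of [Fmap A g b i - b i]. *)
Definition defect b i := g i * mu A b i - b i * (1 + (g i - 1) * mu A b i).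

Lemma Fmap_subE b i : cube b ->
  Fmap A g b i - b i = defect b i / (1 + (g i - 1) * mu A b i).
Proof.
move=> cb; have /andP[d0 _] := fbias_den (g_gt0 i) (mu_itv i cb).
by rewrite /Fmap /fbias /defect; field; rewrite gt_eqF.
Qed.

Lemma Fmap_fixE b i : cube b -> Fmap A g b i = b i <-> defect b i = 0.
Proof.
move=> cb; have /andP[d0 _] := fbias_den (g_gt0 i) (mu_itv i cb).
have dE := Fmap_subE i cb; split=> [Fb|d_0].
  move: dE; rewrite Fb subrr => /esym/eqP.
  by rewrite mulf_eq0 invr_eq0 (gt_eqF d0) orbF => /eqP.
by move: dE; rewrite d_0 mul0r => /subr0_eq.
Qed.

Lemma defect_lip b b' (s : R) i : cube b -> cube b' ->
  (forall j, `|b' j - b j| <= s) ->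
  `|defect b' i - defect b i| <= (1 + g i) * 2 * s.
Proof.
move=> cb cb' bs.
have dmu : `|mu A b' i - mu A b i| <= s.
  have h1 := mu_const (- s) i; have h2 := mu_const s i.
  rewrite muB ler_norml; apply/andP; split; [rewrite -h1|rewrite -h2];
    by apply: mu_le => j; have := bs j; rewrite ler_norml => /andP[].
have /andP[p0 p1] := fbias_den (g_gt0 i) (mu_itv i cb).
have /(fbias_den (g_gt0 i))/andP[q0 q1] : 0 <= 1 - b' i <= 1.
  by have /andP[? ?] := cb' i; apply/andP; split; lra.
(* [defect] is affine in [mu] and in [b i] separately; both coefficients are denominators of
   [fbias], at [1 - b' i] and at [mu A b i], hence at most [1 + g i]. *)
have -> : defect b' i - defect b i =
    (1 + (g i - 1) * (1 - b' i)) * (mu A b' i - mu A b i)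
    - (1 + (g i - 1) * mu A b i) * (b' i - b i) by rewrite /defect; ring.
have -> : (1 + g i) * 2 * s = (1 + g i) * s + (1 + g i) * s by ring.
rewrite (le_trans (ler_normB _ _)) // !normrM (gtr0_norm p0) (gtr0_norm q0).
by apply: lerD; rewrite ler_pM // ltW.
Qed.

Hypothesis conA : graph_connected A.

(** At a fixed point a zero coordinate forces a zero average over the neighbours, so zeros spread
    along edges. Ones spread likewise, through [1 - b]. *)
Lemma fix_zero b i : cube b -> (forall i, defect b i = 0) -> b i = 0 ->
  forall j, b j = 0.
Proof.
move=> cb db bi j.
apply: (edge_propagate (Q := fun j => b j = 0) conA _ _ bi) => {bi i j} i j eij bi.
apply: mu_eq0 eij => [k|]; first by case/andP: (cb k).
have := db i; rewrite /defect bi mul0r subr0 => /eqP.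
by rewrite mulf_eq0 gt_eqF //= => /eqP.
Qed.

Lemma fix_one b i : cube b -> (forall i, defect b i = 0) -> b i = 1 ->
  forall j, b j = 1.
Proof.
move=> cb db bi j.
apply: (edge_propagate (Q := fun j => b j = 1) conA _ _ bi) => {bi i j} i j eij bi.
apply/eqP; rewrite eq_sym -subr_eq0; apply/eqP.
apply: (@mu_eq0 (fun j => 1 - b j)) eij => [k|].
  by case/andP: (cb k) => _; rewrite subr_ge0.
rewrite -muB mu_const; have := db i; rewrite /defect bi; lra.
Qed.

(** * Uniqueness of the fixed point with coordinates in the open unit interval *)

Section Uniqueness.
Variables x y : 'I_n -> R.
Hypotheses (x01 : forall i, 0 < x i < 1) (y01 : forall i, 0 < y i < 1).
Hypotheses (dx : forall i, defect x i = 0) (dy : forall i, defect y i = 0).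

Let cube_int z : (forall i, 0 < z i < 1) -> cube z.
Proof. by move=> z01 i; case/andP: (z01 i) => /ltW-> /ltW->. Qed.

Let mu_int z i : (forall i, 0 < z i < 1) -> defect z i = 0 -> 0 < mu A z i < 1.
Proof.
move=> z01; rewrite /defect; have := mu_itv i (cube_int z01).
have := z01 i; have := g_gt0 i; rewrite !lt_neqAle => g0 /andP[z0 z1] /andP[m0 m1] dz.
rewrite m0 m1 !andbT; apply/andP; split; apply/eqP => m; move: dz.
  by rewrite -m; nra.
by rewrite m; nra.
Qed.

(* If the odds of [x] exceed those of [y] by a factor at most [l], with equality
   at [i], concavity of [fbias ^~ l] forces equality at the neighbours of [i] and
   forces [y] to be constant there. *)
Let odds_step l i : 1 < l ->
  (forall j, x j * (1 - y j) <= l * y j * (1 - x j)) ->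
  x i * (1 - y i) = l * y i * (1 - x i) ->
  forall j, edge A i j ->
    x j * (1 - y j) = l * y j * (1 - x j) /\ y j = mu A y i.
Proof.
move=> l1 le_l eq_i.
have /andP[mx0 mx1] := mu_int x01 (dx i).
have /andP[my0 my1] := mu_int y01 (dy i).
move: (dx i) (dy i) (x01 i) (y01 i) (g_gt0 i).
rewrite /defect; set m := mu A y i in my0 my1 *; set M := mu A x i in mx0 mx1 *.
move=> ex ey /andP[x0 x1] /andP[y0 y1] g0.
(* A fixed point has odds [g i] times those of its average; [g i] cancels in the ratio, so the
   averages [M] and [m] also have odds ratio [l]. *)
have eqM : M * (1 - m) = l * m * (1 - M).
  have e1 : x i * (1 - M) = g i * M * (1 - x i) by lra.
  have e2 : y i * (1 - m) = g i * m * (1 - y i) by lra.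
  have nz : g i * (1 - x i) * y i != 0 by rewrite !mulf_neq0 // gt_eqF // subr_gt0.
  apply: (mulfI nz).
  have -> : g i * (1 - x i) * y i * (M * (1 - m)) =
    g i * M * (1 - x i) * (y i * (1 - m)) by ring.
  rewrite -e1 e2.
  have -> : x i * (1 - M) * (g i * m * (1 - y i)) =
    x i * (1 - y i) * (g i * m * (1 - M)) by ring.
  by rewrite eq_i; ring.
have dm : 0 < 1 + (l - 1) * m by nra.
have ME : M = l * m / (1 + (l - 1) * m).
  have -> : l * m = M * (1 + (l - 1) * m) by lra.
  by rewrite mulfK ?gt_eqF.
(* The tangent at [m] of [fbias ^~ l], which lies above it. *)
pose tgt z := M + l / (1 + (l - 1) * m) ^+ 2 * (z - m).
have tgtE z : 0 < z -> tgt z - l * z / (1 + (l - 1) * z) =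
    l * (l - 1) * (z - m) ^+ 2 / ((1 + (l - 1) * m) ^+ 2 * (1 + (l - 1) * z)).
  move=> z0; rewrite /tgt ME; field; rewrite !gt_eqF //; nra.
have le_f j : x j <= l * y j / (1 + (l - 1) * y j).
  have := le_l j; have /andP[? ?] := y01 j.
  have ? : 0 < 1 + (l - 1) * y j by nra.
  by move=> ?; rewrite ler_pdivlMr //; lra.
have f_tgt j : l * y j / (1 + (l - 1) * y j) <= tgt (y j).
  have /andP[? ?] := y01 j; rewrite -subr_ge0 tgtE //.
  apply: divr_ge0; first by rewrite mulr_ge0 ?sqr_ge0 //; nra.
  by rewrite mulr_ge0 ?sqr_ge0 //; nra.
(* The tangent is affine with value [M] at [m], so the gaps [tgt (y j) - x j], which are
   nonnegative, average to zero and vanish at every neighbour. *)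
have tgt_mu : mu A (fun j => tgt (y j) - x j) i = 0.
  rewrite -muB -/M /tgt.
  pose c := l / (1 + (l - 1) * m) ^+ 2.
  have -> : mu A (fun j => M + c * (y j - m)) i = M + c * (m - m).
    rewrite /mu.
    under eq_bigr do rewrite mulrDr (mulrCA _ c).
    rewrite big_split /= -mulr_suml -mulr_sumr mulrDr mulrA mulVf ?gt_eqF // mul1r.
    rewrite (mulrCA _ c); congr (_ + _ * _).
    rewrite -/(mu A (fun j => y j - m) i) -(muB y (fun=> m)) mu_const //.
  by rewrite subrr mulr0 addr0 subrr.
move=> j eij.
have /(_ j eij) tj : forall j, edge A i j -> tgt (y j) - x j = 0.
  by apply: mu_eq0 tgt_mu => k; rewrite subr_ge0 (le_trans (le_f k)).
have /andP[yj0 yj1] := y01 j.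
have dj : 0 < 1 + (l - 1) * y j by nra.
have xf : x j = l * y j / (1 + (l - 1) * y j).
  by apply/eqP; rewrite eq_le le_f /= (le_trans (f_tgt j)) // -subr_le0 tj.
split.
  by rewrite xf; field; rewrite gt_eqF.
(* A zero gap to the tangent is a zero multiple of [(y j - m) ^+ 2]. *)
have := tgtE _ yj0; rewrite -xf tj => /esym/eqP.
rewrite mulf_eq0 invr_eq0 (gt_eqF (mulr_gt0 (exprn_gt0 _ dm) dj)) orbF.
rewrite mulf_eq0 sqrf_eq0 subr_eq0 => /orP[/eqP|/eqP //]; nra.
Qed.

(** A largest odds ratio [l > 1] would spread to all vertices by [odds_step]. Then [y] and its
    average swap along each edge, so [y] takes at most two values: if they are equal, a vertex with
    [g i1 != 1] gives a contradiction; if they differ, they 2-colour the graph. *)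
Lemma odds_le : ~ graph_bipartite A -> (exists i, g i != 1) ->
  forall i, x i <= y i.
Proof.
move=> nbip [i1 g1] k.
pose lam j := x j * (1 - y j) / (y j * (1 - x j)).
have den j : 0 < y j * (1 - x j).
  by have /andP[? ?] := x01 j; have /andP[? ?] := y01 j; nra.
case: (@arg_maxP _ _ _ k predT lam isT) => i0 _ lmax.
pose l := lam i0.
have le_l j : x j * (1 - y j) <= l * y j * (1 - x j).
  by rewrite -mulrA -ler_pdivrMr //; apply: lmax.
have [l1|l1] := leP l 1.
  have := le_l k; have := den k; nra.
exfalso.
have eq_i0 : x i0 * (1 - y i0) = l * y i0 * (1 - x i0).
  by rewrite -mulrA /l /lam divfK // gt_eqF.
have eq_l j : x j * (1 - y j) = l * y j * (1 - x j).
  pose Q j := x j * (1 - y j) = l * y j * (1 - x j).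
  apply: (edge_propagate (Q := Q) conA _ _ eq_i0) => {}i {}j eij ei.
  by case: (odds_step l1 le_l ei eij).
have nbr i j : edge A i j -> y j = mu A y i.
  by move=> eij; case: (odds_step l1 le_l (eq_l i) eij).
pose a := y i0; pose b := mu A y i0.
have two j : (y j = a /\ mu A y j = b) \/ (y j = b /\ mu A y j = a).
  pose Q j := (y j = a /\ mu A y j = b) \/ (y j = b /\ mu A y j = a).
  apply: (edge_propagate conA (Q := Q) _ (i := i0)); last by left.
  move=> p q epq; rewrite /Q (nbr _ _ epq).
  have /nbr -> : edge A q p by rewrite edge_sym.
  by tauto.
have [ab|ab] := eqVneq a b.
  have yi : mu A y i1 = y i1 by case: (two i1) => -[-> ->].
  have := dy i1; rewrite /defect yi; have /andP[y0 y1] := y01 i1 => e.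
  have : (g i1 - 1) * (y i1 * (1 - y i1)) = 0 by lra.
  move/eqP; rewrite mulf_eq0 subr_eq0 (negPf g1) /= gt_eqF //; nra.
apply: nbip; exists (fun j => y j == a) => i j eij.
by rewrite (nbr _ _ eij); case: (two i) => -[-> ->];
  rewrite eqxx [b == a]eq_sym (negPf ab).
Qed.
End Uniqueness.

Lemma fixpoints_finite : ~ graph_bipartite A -> (exists i, g i != 1) ->
  exists x : 'I_n -> R, forall b, cube b -> (forall i, defect b i = 0) ->
    forall i, [\/ b i = 0, b i = 1 | b i = x i].
Proof.
move=> nbip gN1.
have trich b i : cube b -> (forall i, defect b i = 0) ->
    [\/ b i = 0, b i = 1 | forall j, 0 < b j < 1].
  move=> cb db; have [[j bj]|n0] := pselect (exists j, b j = 0).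
    by apply: Or31; apply: fix_zero bj i.
  have [[j bj]|n1] := pselect (exists j, b j = 1).
    by apply: Or32; apply: fix_one bj i.
  apply: Or33 => j; have /andP[b0 b1] := cb j.
  rewrite !lt_neqAle b0 b1 !andbT; apply/andP; split; apply/eqP => e.
    by apply: n0; exists j.
  by apply: n1; exists j.
have [[x [x01 dx]]|nint] := pselect
  (exists x, (forall i, 0 < x i < 1) /\ (forall i, defect x i = 0)).
  exists x => b cb db i; have [->|->|b01] := trich b i cb db.
  - exact: Or31.
  - exact: Or32.
  - by apply: Or33; apply/le_anti; rewrite !odds_le.
(* Without an interior fixed point the third candidate is arbitrary. *)
exists (fun=> 0) => b cb db i; have [->|->|b01] := trich b i cb db.
- exact: Or31.
- exact: Or32.
- by exfalso; apply: nint; exists b.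
Qed.

End Network.

(** * The Lyapunov function *)

Section Lyapunov.
Variable R : realType.

(* The inverse of [fbias ^~ c] on the unit interval. *)
Definition finv (c x : R) := x / (x + c * (1 - x)).

(** A primitive of [finv c]; at [c = 1], where [finv c] is the identity, the logarithmic formula
    would divide by zero. *)
Definition finv_prim (c x : R) :=
  if c == 1 then x ^+ 2 / 2
  else x / (1 - c) - c / (1 - c) ^+ 2 * ln (c + (1 - c) * x).

Lemma finv_den (c x : R) : 0 < c -> 0 <= x <= 1 ->
  Num.min 1 c <= x + c * (1 - x).
Proof.
move=> c0 /andP[x0 x1]; have [c1|c1] := leP 1 c.
  have : 0 <= (c - 1) * (1 - x) by rewrite mulr_ge0 ?subr_ge0.
  lra.
have : 0 <= (1 - c) * x by rewrite mulr_ge0 // subr_ge0 ltW.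
lra.
Qed.

Lemma finv_den_gt0 (c x : R) : 0 < c -> 0 <= x <= 1 -> 0 < x + c * (1 - x).
Proof. by move=> c0 x01; apply: lt_le_trans (finv_den c0 x01); rewrite lt_min ltr01. Qed.

(** Tangent inequality at [y], derived without derivatives from [ln z <= z - 1] at the ratio
    [z = u / v] of the two denominators. *)
Lemma finv_prim_convex (c x y : R) : 0 < c -> 0 <= x <= 1 -> 0 <= y <= 1 ->
  finv_prim c y - finv_prim c x <= finv c y * (y - x).
Proof.
move=> c0 x01 y01; rewrite /finv_prim /finv.
have u0 := finv_den_gt0 c0 x01; have v0 := finv_den_gt0 c0 y01.
have [->|c1] := eqVneq c 1.
  have -> : y + 1 * (1 - y) = 1 by ring.
  rewrite divr1 -subr_ge0.
  have -> : y * (y - x) - (y ^+ 2 / 2 - x ^+ 2 / 2) = (y - x) ^+ 2 / 2 by field.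
  by rewrite divr_ge0 ?sqr_ge0.
have -> : c + (1 - c) * y = y + c * (1 - y) by ring.
have -> : c + (1 - c) * x = x + c * (1 - x) by ring.
set u := x + c * (1 - x) in u0 *; set v := y + c * (1 - y) in v0 *.
have ln_uv : ln u - ln v <= u / v - 1.
  rewrite -ln_div ?posrE //.
  have := @le_ln1Dx R (u / v - 1); rewrite addrCA subrr addr0; apply.
  by rewrite ltrBDr addNr divr_gt0.
have c1' : 1 - c != 0 by rewrite subr_eq0 eq_sym.
have -> : y / v * (y - x) = (y - x) / (1 - c) + c / (1 - c) ^+ 2 * (u / v - 1).
  by rewrite /u /v; field; rewrite c1' gt_eqF.
have : c / (1 - c) ^+ 2 * (ln u - ln v) <= c / (1 - c) ^+ 2 * (u / v - 1).
  by rewrite ler_wpM2l // divr_ge0 ?sqr_ge0 // ltW.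
lra.
Qed.

Lemma finv_lip (c x y : R) : 0 < c -> 0 <= x <= 1 -> 0 <= y <= 1 ->
  (finv c y - finv c x) * (y - x) <= c / (Num.min 1 c) ^+ 2 * (y - x) ^+ 2.
Proof.
move=> c0 x01 y01; rewrite /finv.
have u0 := finv_den_gt0 c0 x01; have v0 := finv_den_gt0 c0 y01.
have um := finv_den c0 x01; have vm := finv_den c0 y01.
have m0 : 0 < Num.min 1 c by rewrite lt_min ltr01.
have -> : (y / (y + c * (1 - y)) - x / (x + c * (1 - x))) * (y - x) =
    c / ((x + c * (1 - x)) * (y + c * (1 - y))) * (y - x) ^+ 2.
  by field; rewrite !gt_eqF.
rewrite ler_wpM2r ?sqr_ge0 // ler_wpM2l ?(ltW c0) //.
by rewrite lef_pV2 ?posrE ?exprn_gt0 ?mulr_gt0 // expr2 ler_pM // ltW.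
Qed.

Variables (n : nat) (A : 'M[R]_n) (g : 'I_n -> R).
Hypotheses (symA : symmetric_nonneg A) (g_gt0 : forall i, 0 < g i).
Hypothesis deg_gt0A : forall i, 0 < deg A i.

Definition lyapunov (b : 'I_n -> R) : R :=
  (\sum_i \sum_j A i j * b i * b j) / 2 - \sum_i deg A i * finv_prim (g i) (b i).

Definition lyapunov_grad (b : 'I_n -> R) (i : 'I_n) : R :=
  deg A i * (mu A b i - finv (g i) (b i)).

(** On the cube the quadratic form is largest at the all-ones vector, and each primitive is smallest
    at 0, where its slope [finv c 0] vanishes. *)
Lemma lyapunov_ub : exists M : R, forall b, cube b -> lyapunov b <= M.
Proof.
exists ((\sum_i \sum_j A i j) / 2 - \sum_i deg A i * finv_prim (g i) 0).
move=> b cb; rewrite /lyapunov lerB //.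
  rewrite ler_wpM2r ?invr_ge0 //; apply: ler_sum => i _; apply: ler_sum => j _.
  have /andP[? ?] := cb i; have /andP[? ?] := cb j.
  rewrite -mulrA -[leRHS]mulr1 ler_wpM2l ?(weight_ge0 symA) //.
  by rewrite -[leRHS]mulr1 ler_pM.
apply: ler_sum => i _; rewrite ler_wpM2l ?(ltW (deg_gt0A i)) //.
have := finv_prim_convex (g_gt0 i) (cb i) (_ : 0 <= 0 <= 1).
by rewrite lexx ler01 /finv mul0r mul0r subr_le0; apply.
Qed.

Lemma lyapunov_step : exists2 C : R, 0 <= C & forall b b' (s : R), cube b -> cube b' ->
  (forall i, `|b' i - b i| <= s) ->
  lyapunov b + \sum_i lyapunov_grad b i * (b' i - b i) - C * s ^+ 2 <= lyapunov b'.
Proof.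
pose L i := g i / (Num.min 1 (g i)) ^+ 2.
exists ((\sum_i \sum_j A i j) / 2 + \sum_i deg A i * L i).
  apply: addr_ge0.
    rewrite divr_ge0 //; apply: sumr_ge0 => i _; apply: sumr_ge0 => j _.
    exact: weight_ge0.
  apply: sumr_ge0 => i _; rewrite mulr_ge0 ?(ltW (deg_gt0A i)) //.
  by rewrite divr_ge0 ?sqr_ge0 ?(ltW (g_gt0 i)).
move=> b b' s cb cb' bs.
pose del i := b' i - b i.
have bE i : b' i = b i + del i by rewrite /del addrCA subrr addr0.
have quad : \sum_i \sum_j A i j * b' i * b' j = \sum_i \sum_j A i j * b i * b j
    + (\sum_i deg A i * mu A b i * del i) * 2 + \sum_i \sum_j A i j * del i * del j.
  have -> : \sum_i deg A i * mu A b i * del i = \sum_i \sum_j A i j * b j * del i.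
    by apply: eq_bigr => i _; rewrite deg_mu // mulr_suml.
  rewrite mulr2n mulrDr mulr1 [X in _ + (_ + X) + _]exchange_big /=.
  rewrite -!big_split /=; apply: eq_bigr => i _; rewrite -!big_split /=.
  apply: eq_bigr => j _; rewrite !bE; case: (symA i j) => -> _; ring.
have quad_ge : - ((\sum_i \sum_j A i j) * s ^+ 2) <= \sum_i \sum_j A i j * del i * del j.
  rewrite mulr_suml -sumrN; apply: ler_sum => i _.
  rewrite mulr_suml -sumrN; apply: ler_sum => j _.
  rewrite -mulrA -mulrN ler_wpM2l ?(weight_ge0 symA) // lerNl.
  rewrite (le_trans (ler_norm _)) // normrN normrM expr2.
  by rewrite ler_pM // bs.
(* Convexity bounds each increment by the slope at the new point; [finv_lip] moves the slope back to
   the old point at quadratic cost. *)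
have lin : \sum_i deg A i * finv_prim (g i) (b' i) <= \sum_i deg A i * finv_prim (g i) (b i)
   + \sum_i deg A i * finv (g i) (b i) * del i + (\sum_i deg A i * L i) * s ^+ 2.
  rewrite mulr_suml -!big_split /=; apply: ler_sum => i _.
  have h1 := finv_prim_convex (g_gt0 i) (cb i) (cb' i).
  have h2 := finv_lip (g_gt0 i) (cb i) (cb' i).
  have h3 : L i * (b' i - b i) ^+ 2 <= L i * s ^+ 2.
    rewrite ler_wpM2l //.
      by rewrite divr_ge0 ?sqr_ge0 ?(ltW (g_gt0 i)).
    by rewrite -real_normK ?num_real // lerXn2r ?nnegrE ?bs // (le_trans _ (bs i)).
  rewrite -(mulrA _ _ (del i)) -(mulrA _ (L i)) -!mulrDr.
  rewrite ler_wpM2l ?(ltW (deg_gt0A i)) //.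
  rewrite -/(L i) -/(del i) in h1 h2 h3; lra.
have grad : \sum_i lyapunov_grad b i * (b' i - b i) =
   \sum_i deg A i * mu A b i * del i - \sum_i deg A i * finv (g i) (b i) * del i.
  rewrite -sumrB; apply: eq_bigr => i _; rewrite /lyapunov_grad /del; ring.
rewrite /lyapunov grad quad; lra.
Qed.

(** Both [mu A b i - finv (g i) (b i)] and [Fmap A g b i - b i] equal [defect A g b i] over a
    positive denominator at most [1 + g i]. *)
Lemma lyapunov_drift b i : cube b ->
  deg A i / (1 + g i) ^+ 2 * defect A g b i ^+ 2
    <= lyapunov_grad b i * (Fmap A g b i - b i).
Proof.
move=> cb; rewrite (Fmap_subE symA g_gt0 deg_gt0A) // /lyapunov_grad /finv.
have /andP[d0 d1] := fbias_den (g_gt0 i) (mu_itv symA deg_gt0A i cb).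
have e0 := finv_den_gt0 (g_gt0 i) (cb i).
have e1 : b i + g i * (1 - b i) <= 1 + g i.
  have /andP[? ?] := cb i; have := mulr_ge0 (ltW (g_gt0 i)) (_ : 0 <= b i).
  by lra.
have -> : mu A b i - b i / (b i + g i * (1 - b i)) =
    defect A g b i / (b i + g i * (1 - b i)).
  by rewrite /defect; field; rewrite gt_eqF.
rewrite -!mulrA ler_wpM2l ?(ltW (deg_gt0A i)) //.
rewrite [leRHS](_ : _ = ((b i + g i * (1 - b i)) * (1 + (g i - 1) * mu A b i))^-1
   * defect A g b i ^+ 2); last by field; rewrite !gt_eqF.
rewrite ler_wpM2r ?sqr_ge0 // lef_pV2 ?posrE ?exprn_gt0 ?mulr_gt0 //; last first.
  by have := g_gt0 i; lra.
by rewrite expr2 ler_pM // ltW.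
Qed.

End Lyapunov.

(** * Convergence of slow sequences *)

Section Sequences.
Variable R : realType.

(* The increments of [r ^+ 3] are dominated by the summable terms
   [r k ^+ 2 / (k + 2)], and the divergence of the harmonic series rules out a
   nonzero limit. *)
Lemma slow_weighted_sqsum_cvg0 (r : nat -> R) (K M : R) :
  (forall k, `|r k.+1 - r k| <= K / k.+2%:R) ->
  (forall N, \sum_(k < N) r k ^+ 2 / k.+2%:R <= M) ->
  r @ \oo --> (0 : R).
Proof.
move=> rK rM.
have K0 : 0 <= K.
  by have := le_trans (normr_ge0 _) (rK 0%N); rewrite pmulr_lge0 // invr_gt0.
pose a k := r k ^+ 2 / k.+2%:R.
have a0 k : 0 <= a k by rewrite divr_ge0 ?sqr_ge0.
have aM N : \sum_(k < N) a k <= M by apply: rM.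
have aM' N : \sum_(k < N) a k.+1 <= M.
  by apply: le_trans (aM N.+1); rewrite big_ord_recl lerDr.
pose u k := r k ^+ 3.
have u_tel k : `|telescope u k| <= K * (2 * a k + 4 * a k.+1).
  have -> : telescope u k = (r k.+1 - r k) * (r k.+1 ^+ 2 + r k.+1 * r k + r k ^+ 2).
    rewrite /telescope /u /=; ring.
  rewrite normrM; apply: le_trans (_ : K / k.+2%:R * (2 * r k ^+ 2 + 2 * r k.+1 ^+ 2) <= _).
    apply: ler_pM => //.
    have h1 : 0 <= (r k.+1 + r k) ^+ 2 by exact: sqr_ge0.
    have h2 : 0 <= (r k.+1 - r k) ^+ 2 by exact: sqr_ge0.
    have h3 := sqr_ge0 (r k.+1); have h4 := sqr_ge0 (r k).
    rewrite ler_norml; apply/andP; split; lra.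
  rewrite -mulrA ler_wpM2l // mulrDr /a mulrCA (mulrC _ (r k ^+ 2)) lerD2l.
  rewrite mulrCA (mulrC _ (r k.+1 ^+ 2)).
  (* The weight of [a k.+1] enters through [1 / (k + 2) <= 2 / (k + 3)]. *)
  have -> : 4 * (r k.+1 ^+ 2 / k.+3%:R) = 2 * (r k.+1 ^+ 2 * (2 / k.+3%:R)) :> R by ring.
  rewrite !ler_wpM2l ?sqr_ge0 // ler_pdivlMr // mulrC ler_pdivrMr //.
  by rewrite -natrM ler_nat mul2n -addnn addnS !ltnS; apply: leq_addr.
have /normed_cvg cu : cvgn [normed series (telescope u)].
  apply: nondecreasing_is_cvgn.
    by apply: nondecreasing_series => k _ _; exact: normr_ge0.
  exists (K * (2 * M + 4 * M)) => _ [N _ <-]; rewrite /normed_series_of seriesEord /=.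
  apply: (le_trans (ler_sum _ (fun (k : 'I_N) _ => u_tel k))).
  rewrite -mulr_sumr ler_wpM2l // big_split /= -!mulr_sumr.
  by apply: lerD; rewrite ler_wpM2l ?aM ?aM'.
have {cu} [l ul] : exists l : R, u @ \oo --> l.
  pose s : nat -> R := series (telescope u).
  have {}cu : cvgn s by exact: cu.
  have us n : u n = u 0%N + s n by exact: eq_sum_telescope.
  exists (u 0%N + limn s); under eq_cvg do rewrite us.
  by apply: cvgD; [exact: cvg_cst|exact: cu].
have [l0|l0] := eqVneq l 0.
  apply/cvgr0Pnorm_lt => e e0.
  have /cvgr0Pnorm_lt/(_ (e ^+ 3)) : u @ \oo --> (0 : R) by rewrite -l0.
  rewrite exprn_gt0 // => /(_ isT); apply: filterS => k.
  by rewrite normrX ltr_pXn2r // nnegrE ltW.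
exfalso.
(* Eventually the cube of [r k] has modulus at least half of [l]; its square is then at least 1, or
   at least that cube when the modulus of [r k] is below 1. *)
pose c := Num.min 1 (`|l| / 2).
have c0 : 0 < c by rewrite lt_min ltr01 divr_gt0 // normr_gt0.
have [N _ rN] : \forall k \near \oo, c <= r k ^+ 2.
  have /cvgrPdist_lt/(_ (`|l| / 2)) := ul.
  rewrite divr_gt0 ?normr_gt0 // => /(_ isT); apply: filterS => k lk.
  have uk : `|l| / 2 <= `|r k| ^+ 3.
    by have := ler_dist_dist l (u k); have := ler_norm (`|l| - `|u k|); rewrite -normrX -/(u k); lra.
  rewrite /c ge_min -real_normK ?num_real //; case: (leP 1 (`|r k|)) => r1.
    by rewrite exprn_ege1.
  have r0 : 0 < `|r k|.
    rewrite lt0r normr_ge0 andbT; apply/eqP => r_0.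
    move: uk; rewrite r_0 expr0n /= leNgt divr_gt0 ?normr_gt0 //.
  by rewrite (le_trans uk) ?orbT // exprSr ger_pMr ?exprn_gt0 // ltW.
apply: (@dvg_harmonic R); apply: nondecreasing_is_cvgn.
  by apply: nondecreasing_series => k _ _; exact: harmonic_ge0.
pose H := \sum_(k < N.+1) (k.+1%:R : R)^-1.
exists (H + M / c) => _ [m _ <-]; rewrite seriesEord /= /harmonic.
have hge0 k : 0 <= (k.+1%:R : R)^-1 by rewrite invr_ge0.
(* Beyond [N] each harmonic term is at most [a (N + k) / c], so bounded sums of [a] would bound the
   harmonic series. *)
have key p : \sum_(k < N.+1 + p) (k.+1%:R : R)^-1 <= H + (\sum_(k < p) a (N + k)%N) / c.
  rewrite big_split_ord /= lerD2l mulr_suml; apply: ler_sum => k _.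
  rewrite ler_pdivlMr // mulrC /a addSn ler_wpM2r //.
  by apply: rN; rewrite /= leq_addr.
have le_m : \sum_(k < m) (k.+1%:R : R)^-1 <= \sum_(k < N.+1 + m) (k.+1%:R : R)^-1.
  by rewrite addnC big_split_ord /= lerDl sumr_ge0.
apply: (le_trans le_m); apply: (le_trans (key m)); rewrite lerD2l ler_wpM2r ?invr_ge0 ?(ltW c0) //.
by apply: le_trans (aM (N + m)%N); rewrite big_split_ord /= lerDr sumr_ge0.
Qed.

Lemma exists_gap (S : seq R) : exists2 e, 0 < e &
  forall a b, a \in S -> b \in S -> `|a - b| < e -> a = b.
Proof.
have gap1 (a : R) (T : seq R) : exists2 e, 0 < e & forall b, b \in T -> `|a - b| < e -> a = b.
  elim: T => [|x T [e e0 IH]]; first by exists 1.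
  have [ax|ax] := eqVneq a x.
    by exists e => // b; rewrite inE => /predU1P[->|/IH].
  exists (Num.min e `|a - x|); first by rewrite lt_min e0 normr_gt0 subr_eq0.
  move=> b; rewrite inE lt_min => /predU1P[->|bT] /andP[h1 h2].
    by rewrite ltxx in h2.
  exact: IH h1.
elim: S => [|x S [e e0 IH]]; first by exists 1.
have [e' e'0 h] := gap1 x S.
exists (Num.min e e'); first by rewrite lt_min e0.
move=> a b; rewrite !inE lt_min => /predU1P[->|aS] /predU1P[->|bS] /andP[h1 h2] //.
- exact: h.
- by apply/esym/h; rewrite // distrC.
- exact: IH.
Qed.

(** With [e] a gap of [S], once the steps and the distances to [S] are below [e / 3], consecutive
    terms are close to the same point of [S]. *)
Lemma finite_adherence_cvg (u : nat -> R) (S : seq R) :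
  (fun k => u k.+1 - u k) @ \oo --> (0 : R) ->
  (forall e, 0 < e -> \forall k \near \oo, exists2 a, a \in S & `|u k - a| < e) ->
  exists a : R, u @ \oo --> a.
Proof.
move=> du uS; have [e e0 gap] := exists_gap S.
have e3 : 0 < e / 3 by rewrite divr_gt0.
have [N1 _ duN] := (cvgr0Pnorm_lt _).1 du _ e3.
have [N2 _ uN] := uS _ e3.
pose N := maxn N1 N2.
have [a aS ua] := uN N (leq_maxr _ _); exists a.
have stay k : (N <= k)%N -> `|u k - a| < e / 3.
  elim: k => [|k IH]; first by rewrite leqn0 => /eqP N0; move: ua; rewrite N0.
  rewrite leq_eqVlt ltnS => /predU1P[<- //|Nk].
  have [b bS ub] := uN k.+1 (leq_trans (leq_trans (leq_maxr N1 N2) Nk) (leqnSn k)).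
  suff -> : a = b by [].
  apply: gap => //; have := duN k (leq_trans (leq_maxl N1 N2) Nk); have := IH Nk.
  rewrite /= !ltr_norml in ub *; lra.
apply/cvgrPdist_lt => d d0.
have m0 : 0 < Num.min d (e / 3) by rewrite lt_min d0.
near=> k.
have Nk : (N <= k)%N by near: k; exact: nbhs_infty_ge.
have [b bS] : exists2 b, b \in S & `|u k - b| < Num.min d (e / 3).
  by near: k; exact: uS.
rewrite lt_min => /andP[ubd ube].
suff -> : a = b by rewrite distrC.
apply: gap => //; have := stay k Nk; move: ube; rewrite !ltr_norml; lra.
Unshelve. all: by end_near. Qed.

End Sequences.

(** * From vanishing defects to convergence, by compactness *)

Section Convergence.
Variables (R : realType) (n : nat) (A : 'M[R]_n) (g : 'I_n -> R).

Lemma defect_cvg (T : Type) (F : set_system T) {FF : Filter F}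
    (b : T -> 'I_n -> R) (c : 'I_n -> R) :
  (forall j, b x j @[x --> F] --> c j) ->
  forall i, defect A g (b x) i @[x --> F] --> defect A g c i.
Proof.
move=> bc i; have muc : mu A (b x) i @[x --> F] --> mu A c i.
  apply: cvgM; first exact: cvg_cst.
  apply: cvg_big => [|j _]; first exact: add_continuous.
  by apply: cvgM; [exact: cvg_cst|exact: bc].
rewrite /defect; apply: cvgB; first by apply: cvgM; [exact: cvg_cst|exact: muc].
apply: cvgM; first exact: bc.
apply: cvgD; first exact: cvg_cst.
by apply: cvgM; [exact: cvg_cst|exact: muc].
Qed.

(** Row vectors provide the topology in which the compactness argument takes place. *)
Let defect2 (v : 'rV[R]_n) := \sum_j defect A g (v ord0) j ^+ 2.

Let defect2_continuous : continuous defect2.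
Proof.
apply: continuous_big => [|j _ v]; first exact: add_continuous.
have dv : {for v, continuous (fun w : 'rV[R]_n => defect A g (w ord0) j)}.
  apply: (@defect_cvg 'rV[R]_n (nbhs v) (nbhs_filter v) (fun w => w ord0)) => k.
  exact: coord_continuous.
exact: (@cvgM _ _ _ (nbhs_filter v) _ _ _ _ dv dv).
Qed.

Variable b : nat -> 'I_n -> R.
Hypothesis cb : forall k, cube (b k).
Hypothesis db : forall i, (fun k => defect A g (b k) i) @ \oo --> (0 : R).

Let defect2_cvg0 : (fun k => defect2 (\row_j b k j)) @ \oo --> (0 : R).
Proof.
have -> : 0 = \sum_(j < n) 0 ^+ 2 :> R by rewrite big1 // => j _; rewrite expr0n.
apply: cvg_big => [|j _]; first exact: add_continuous.
rewrite expr2; under eq_cvg => k.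
  rewrite expr2 (_ : (\row_j b k j) ord0 = b k); last by apply/funext => l; rewrite mxE.
  over.
by apply: cvgM; exact: db.
Qed.

(* A continuous function vanishing only at the fixed points is bounded away from
   [0] on the compact set of points whose [i]-th coordinate is far from [S]. *)
Lemma near_fix_coord i (S : seq R) :
  (forall c, cube c -> (forall j, defect A g c j = 0) -> c i \in S) ->
  forall e, 0 < e -> \forall k \near \oo, exists2 a, a \in S & `|b k i - a| < e.
Proof.
move=> fixS e e0.
pose far := [set x : R | forall a, a \in S -> e <= `|x - a|].
pose box j := `[0, 1] `&` (if j == i then far else setT).
pose K := [set v : 'rV[R]_n | forall j, box j (v ord0 j)].
have cK : compact K.
  apply: rV_compact => j; apply: compact_closedI; first exact: segment_compact.
  case: ifP => _; last exact: closedT.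
  rewrite (_ : far = \bigcap_(a in [set` S]) ((fun x => `|x - a|) @^-1` [set y | e <= y])).
    apply: closed_bigI => a _; apply: preimage_closed; last exact: closed_ge.
    move=> x _; apply: cvg_norm; apply: cvgB; [exact: cvg_id|exact: cvg_cst].
  by apply/seteqP; split.
have bK k : K (\row_j b k j) \/ (exists2 a, a \in S & `|b k i - a| < e).
  have [|nS] := pselect (exists2 a, a \in S & `|b k i - a| < e); first by right.
  left=> j; rewrite mxE; split; first by rewrite /= in_itv /=; exact: cb.
  case: eqP => // -> a aS; rewrite leNgt; apply/negP => lt_e.
  by apply: nS; exists a.
have [K0|] := pselect (K !=set0); last first.
  move=> nK0; near=> k; case: (bK k) => // Kk.
  by exfalso; apply: nK0; exists (\row_j b k j).
have /(compact_EVT_min K0 cK)[v vK vmin] : {within K, continuous defect2}.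
  exact: continuous_subspaceT.
rewrite inE in vK.
have v_gt0 : 0 < defect2 v.
  have ge0 : 0 <= defect2 v by apply: sumr_ge0 => j _; exact: sqr_ge0.
  rewrite lt_neqAle ge0 andbT; apply/eqP => /esym/psumr_eq0P d0.
  case: (vK i) => _; rewrite eqxx /= => far_v.
  have vS : v ord0 i \in S.
    apply: fixS => j; first by case: (vK j) => /=; rewrite in_itv.
    by apply/eqP; rewrite -sqrf_eq0 d0 // => l _; exact: sqr_ge0.
  by have := far_v _ vS; rewrite subrr normr0 leNgt e0.
near=> k; case: (bK k) => // Kk; exfalso.
have := vmin (\row_j b k j); rewrite inE => /(_ Kk); apply/negP; rewrite -ltNge.
near: k; have /cvgr0Pnorm_lt/(_ _ v_gt0) := defect2_cvg0.
by apply: filterS => k; apply: le_lt_trans; exact: ler_norm.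
Unshelve. all: by end_near. Qed.

(** Each coordinate converges on its own, since it approaches [[:: 0; 1; x i]] with vanishing steps;
    continuity of [defect] makes the limit a fixed point. *)
Lemma cvg_to_fix (x : 'I_n -> R) :
  (forall i, (fun k => b k.+1 i - b k i) @ \oo --> (0 : R)) ->
  (forall c, cube c -> (forall j, defect A g c j = 0) ->
     forall i, [\/ c i = 0, c i = 1 | c i = x i]) ->
  exists2 c, cube c & (forall i, defect A g c i = 0) /\
    forall i, (fun k => b k i) @ \oo --> c i.
Proof.
move=> stepb fixx.
have /choice[c bc] i : exists a : R, (fun k => b k i) @ \oo --> a.
  apply: (@finite_adherence_cvg _ _ [:: 0; 1; x i]) => //.
  apply: near_fix_coord => a ca da; rewrite !inE.
  by case: (fixx a ca da i) => ->; rewrite eqxx ?orbT.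
exists c.
  move=> i; apply/andP; split.
    by apply: (cvgr_to_ge (bc i)); near=> k; case/andP: (cb k i).
  by apply: (cvgr_to_le (bc i)); near=> k; case/andP: (cb k i).
split=> // i; apply: cvg_unique (db i); first exact: norm_hausdorff.
exact: defect_cvg.
Unshelve. all: by end_near. Qed.

End Convergence.

(** * Finitely valued random variables *)

Section FiniteValued.
Context (d : measure_display) (Omega : measurableType d) (R : realType).
Variable P : probability Omega R.

(** Only fibres are tested: for a finite [T] this yields all preimages, with no sigma-algebra chosen
    on [T]. *)
Definition fin_measurable (T : Type) (X : Omega -> T) :=
  forall t, measurable (X @^-1` [set t]).

Lemma fin_measurable_comp (T : finType) (U : Type) (X : Omega -> T) (f : T -> U) :
  fin_measurable X -> forall B : set U, measurable ((f \o X) @^-1` B).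
Proof.
move=> mX B; rewrite (_ : _ @^-1` _ = \bigcup_(t in f @^-1` B) X @^-1` [set t]).
  by apply: fin_bigcup_measurable => [|t _]; [exact: finite_finset|exact: mX].
by apply/seteqP; split=> [w fB|w [t tB] /= ->//]; exists (X w).
Qed.

Lemma fin_measurable_pair (T U : Type) (X : Omega -> T) (Y : Omega -> U) :
  fin_measurable X -> fin_measurable Y -> fin_measurable (fun w => (X w, Y w)).
Proof.
move=> mX mY [t u]; rewrite (_ : _ @^-1` _ = X @^-1` [set t] `&` Y @^-1` [set u]).
  exact: measurableI.
by apply/seteqP; split=> w /= [Xw Yw]; [split|rewrite Xw Yw].
Qed.

Lemma fin_measurable_ffun (I T : finType) (X : I -> Omega -> T) :
  (forall i, fin_measurable (X i)) -> fin_measurable (fun w => [ffun i => X i w]).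
Proof.
move=> mX t; rewrite (_ : _ @^-1` _ = \bigcap_(i in setT) (X i @^-1` [set t i])).
  by apply: fin_bigcap_measurable => [|i _]; [exact: finite_finset|exact: mX].
apply/seteqP; split=> [w /= <- i _|w /= h]; first by rewrite /= ffunE.
by apply/ffunP => i; rewrite ffunE; exact: h.
Qed.

Variables (T : finType) (X : Omega -> T).
Hypothesis mX : fin_measurable X.

Lemma fin_measurable_fun (f : T -> R) : measurable_fun setT (f \o X).
Proof. by move=> _ B _; rewrite setTI; exact: fin_measurable_comp. Qed.

Lemma fin_integrable (f : T -> R) : P.-integrable setT (EFin \o (f \o X)).
Proof.
apply: measurable_bounded_integrable => //.
- by rewrite (le_lt_trans (probability_le1 P _)) ?ltry.
- exact: fin_measurable_fun.
exists (\sum_t `|f t|); split; first exact: num_real.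
move=> M ltM w _; apply: le_trans (ltW ltM).
by rewrite /= (bigD1 (X w)) //= lerDl sumr_ge0.
Qed.

Lemma fin_Rintegral (f : T -> R) :
  \int[P]_w f (X w) = \sum_t f t * fine (P (X @^-1` [set t])).
Proof.
rewrite /Rintegral (eq_integral (fun w => \sum_t (f t)%:E * (\1_(X @^-1` [set t]) w)%:E)%E).
  rewrite integral_sum //; last first.
    by move=> t; apply: integrableZl => //; exact: integrable_indic.
  rewrite -sum_fine; last first.
    move=> t _; rewrite integralZl //; last exact: integrable_indic.
    by rewrite integral_indic // fin_numM // setIT fin_num_measure.
  apply: eq_bigr => t _; rewrite integralZl //; last exact: integrable_indic.
  by rewrite integral_indic // setIT fineM // fin_num_measure.
move=> w _; rewrite (bigD1 (X w)) //= big1 ?adde0 => [|t tX].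
  by rewrite indicE mem_set // mule1.
by rewrite indicE memNset ?mule0 //= => /esym/eqP; rewrite (negPf tX).
Qed.

End FiniteValued.

Section BernoulliProduct.
Variables (R : realType) (n : nat) (p : 'I_n -> R).

(** Once the centred term is absorbed into the [i]-th factor, the sum over vectors is a product of
    sums, whose [i]-th factor is [(1 - p i) * p i - p i * (1 - p i)]. *)
Lemma bernoulli_product_centered i :
  \sum_(e : {ffun 'I_n -> bool})
     ((e i)%:R - p i) * \prod_j (if e j then p j else 1 - p j) = 0.
Proof.
pose F j (x : bool) := (if j == i then x%:R - p i else 1) * (if x then p j else 1 - p j).
have -> : \sum_(e : {ffun 'I_n -> bool})
     ((e i)%:R - p i) * \prod_j (if e j then p j else 1 - p j) =
   \sum_(e : {ffun 'I_n -> bool}) \prod_j F j (e j).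
  apply: eq_bigr => e _; rewrite big_split /=; congr (_ * _).
  by rewrite -big_mkcond big_pred1_eq.
rewrite -bigA_distr_bigA /= (bigD1 i) //= big_bool /F eqxx /=.
rewrite [X in X * _](_ : _ = 0) ?mul0r //; ring.
Qed.

End BernoulliProduct.

(** * The random opinions *)

Section Process.
Context (d : measure_display) (Omega : measurableType d) (R : realType).
Variables (n : nat) (A : 'M[R]_n) (gam b1 : 'I_n -> R) (P : probability Omega R).
Variable psi : nat -> 'I_n -> Omega -> bool.
Hypotheses (symA : symmetric_nonneg A) (gam_gt0 : forall i, 0 < gam i).
Hypothesis deg_gt0A : forall i, 0 < deg A i.
Hypothesis b1_01 : forall i, 0 < b1 i < 1.

Lemma betaS_cube (h : nat -> 'I_n -> bool) k : cube (betaS b1 h k).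
Proof.
elim: k => [|k IH] i /=; first by case/andP: (b1_01 i) => /ltW-> /ltW->.
have /andP[h0 h1] := IH i.
have psi1 : ((h k.+2 i)%:R : R) <= 1 by case: (h _ _).
rewrite -mulrAC -mulrDl; apply/andP; split.
  by rewrite divr_ge0 // addr_ge0 ?mulr_ge0.
rewrite ler_pdivrMr // mul1r -[leRHS]natr1.
by apply: lerD => //; rewrite ler_piMr.
Qed.

Lemma betaS_incr (h : nat -> 'I_n -> bool) k i :
  betaS b1 h k.+1 i - betaS b1 h k i = ((h k.+2 i)%:R - betaS b1 h k i) / k.+2%:R.
Proof.
rewrite /= -[k.+2%:R]natr1.
have : k.+1%:R + 1 != 0 :> R by rewrite natr1 pnatr_eq0.
by move: (h _ _)%:R (betaS _ _ _ _) => u v; move: k.+1%:R => x x0; field.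
Qed.

Lemma betaS_incr_le (h : nat -> 'I_n -> bool) k i :
  `|betaS b1 h k.+1 i - betaS b1 h k i| <= k.+2%:R^-1.
Proof.
rewrite betaS_incr normrM normfV (ger0_norm (ler0n _ _)) ler_piMl ?invr_ge0 //.
have /andP[h0 h1] := betaS_cube h k i.
by rewrite ler_norml; case: (h _ _) => /=; apply/andP; split; lra.
Qed.

Lemma eq_betaS (h h' : nat -> 'I_n -> bool) k :
  (forall s i, (2 <= s <= k.+1)%N -> h s i = h' s i) ->
  betaS b1 h k = betaS b1 h' k.
Proof.
elim: k => //= k IH hh'; apply/funext => i; rewrite IH ?hh' ?leqnn //.
by move=> s j /andP[s2 sk]; apply: hh'; rewrite s2 (leq_trans sk).
Qed.

(** Times 2 to [k + 1], the ones that determine beta(k + 1), packed into a finite type so that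
    integrals become finite sums. *)
Definition history k (w : Omega) : {ffun 'I_k * 'I_n -> bool} :=
  [ffun p : 'I_k * 'I_n => psi p.1.+2 p.2 w].

(* Junk value [false] at times outside 2..k+1, which [betaS b1 _ k] ignores. *)
Definition declarations k (h : {ffun 'I_k * 'I_n -> bool}) (s : nat) (i : 'I_n) :=
  if insub s.-2 is Some t then h (t, i) else false.

Lemma declarations_history k w s i : (2 <= s <= k.+1)%N ->
  declarations (history k w) s i = psi s i w.
Proof.
by move: s => [|[|s]] //= sk; rewrite /declarations /= insubT ffunE.
Qed.

Lemma declarationsK k w (h : {ffun 'I_k * 'I_n -> bool}) :
  history k w = h <->
  forall s i, (2 <= s <= k.+1)%N -> psi s i w = declarations h s i.
Proof.
split=> [<- s i sk|hw]; first by rewrite declarations_history.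
apply/ffunP => -[t i]; rewrite ffunE /= hw ?ltnS ?ltn_ord //.
by rewrite /declarations /= valK.
Qed.

(* This is beta(k + 1). *)
Definition opinion k w : 'I_n -> R := betaS b1 (fun s j => psi s j w) k.

Definition opinion_of k (h : {ffun 'I_k * 'I_n -> bool}) : 'I_n -> R :=
  betaS b1 (declarations h) k.

Lemma opinion_history k w : opinion k w = opinion_of (history k w).
Proof. by apply: eq_betaS => s i sk; rewrite declarations_history. Qed.

Hypothesis mpsi : forall t i, measurable [set w | psi t i w].

Let mpsi' t i : fin_measurable (psi t i).
Proof.
move=> [|]; first by rewrite [X in measurable X](_ : _ = [set w | psi t i w]).
rewrite [X in measurable X](_ : _ = ~` [set w | psi t i w]); first exact: measurableC.
by apply/seteqP; split=> w /= => [->|/negP/negPf].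
Qed.

Lemma history_measurable k : fin_measurable (history k).
Proof. by apply: fin_measurable_ffun => p; exact: mpsi'. Qed.

Definition next_declaration k (w : Omega) : {ffun 'I_n -> bool} :=
  [ffun i => psi k.+2 i w].

Lemma next_measurable k :
  fin_measurable (fun w => (history k w, next_declaration k w)).
Proof.
apply: fin_measurable_pair; first exact: history_measurable.
by apply: fin_measurable_ffun => i; exact: mpsi'.
Qed.

Hypothesis law : forall (t : nat) (h : nat -> 'I_n -> bool) (e : 'I_n -> bool),
  (1 <= t)%N ->
  let Ht := [set w | forall s i, (2 <= s <= t)%N -> psi s i w = h s i] in
  let bt := beta b1 h t in
  P (Ht `&` [set w | forall i, psi t.+1 i w = e i])
  = (P Ht * (\prod_i (if e i then Fmap A gam bt i else 1 - Fmap A gam bt i))%:E)%E.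

Lemma law_next k (h : {ffun 'I_k * 'I_n -> bool}) (e : {ffun 'I_n -> bool}) :
  let F := Fmap A gam (opinion_of h) in
  fine (P ((fun w => (history k w, next_declaration k w)) @^-1` [set (h, e)])) =
  fine (P (history k @^-1` [set h])) * \prod_i (if e i then F i else 1 - F i).
Proof.
move=> F; pose Ht := [set w | forall s i, (2 <= s <= k.+1)%N ->
  psi s i w = declarations h s i].
have HtE : history k @^-1` [set h] = Ht.
  by apply/seteqP; split=> w /declarationsK.
have mHt : measurable Ht by rewrite -HtE; exact: history_measurable.
rewrite (_ : _ @^-1` [set (h, e)] = Ht `&` [set w | forall i, psi k.+2 i w = e i]).
  by rewrite HtE law // fineM // fin_num_measure.
rewrite -HtE; apply/seteqP; split=> w /=.
  by move=> [-> <-]; split=> // i; rewrite ffunE.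
by move=> [-> hw]; congr (_, _); apply/ffunP => i; rewrite ffunE.
Qed.

(** This orthogonality to functions of the history stands in for a conditional expectation: for each
    fixed history, the sum over the next declarations is a centred Bernoulli sum. *)
Lemma martingale_increment k (phi : {ffun 'I_k * 'I_n -> bool} -> R) i :
  \int[P]_w (phi (history k w) *
    ((psi k.+2 i w)%:R - Fmap A gam (opinion k w) i)) = 0.
Proof.
pose f (u : {ffun 'I_k * 'I_n -> bool} * {ffun 'I_n -> bool}) :=
  phi u.1 * ((u.2 i)%:R - Fmap A gam (opinion_of u.1) i).
transitivity (\int[P]_w f (history k w, next_declaration k w)).
  by apply: eq_Rintegral => w _; rewrite /f /= opinion_history ffunE.
rewrite (fin_Rintegral P (@next_measurable k)).
pose pr h e := fine (P ((fun w => (history k w, next_declaration k w)) @^-1` [set (h, e)])).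
transitivity (\sum_h \sum_e f (h, e) * pr h e).
  by rewrite pair_bigA /=; apply: eq_bigr => -[h e].
apply: big1 => h _.
under eq_bigr do rewrite /pr law_next /f /= mulrACA.
by rewrite -mulr_sumr bernoulli_product_centered mulr0.
Qed.

(** The lower bound of [lyapunov_drift] for the growth of the Lyapunov function, summed over
    agents. *)
Definition drift (b : 'I_n -> R) : R :=
  \sum_i deg A i / (1 + gam i) ^+ 2 * defect A gam b i ^+ 2.

Lemma drift_ge0 b : 0 <= drift b.
Proof.
apply: sumr_ge0 => i _; rewrite mulr_ge0 ?sqr_ge0 // divr_ge0 ?sqr_ge0 //.
exact: ltW.
Qed.

(** Telescoping: [1 / (k + 2) ^ 2 <= 1 / (k + 1) - 1 / (k + 2)]. *)
Lemma sum_inv_sqr N : \sum_(k < N) (k.+2%:R ^+ 2)^-1 <= 1 :> R.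
Proof.
suff : \sum_(k < N) (k.+2%:R ^+ 2)^-1 <= 1 - N.+1%:R^-1 :> R.
  by move/le_trans; apply; rewrite gerBl.
elim: N => [|N IH]; first by rewrite big_ord0 invr1 subrr.
rewrite big_ord_recr /=; apply: le_trans (lerD IH (lexx _)) _.
have x0 : 0 < N.+1%:R :> R by [].
rewrite -[N.+2%:R]natr1; move: (N.+1%:R) x0 => x x0.
rewrite -subr_ge0.
rewrite [leRHS](_ : _ = (x * (x + 1) ^+ 2)^-1); last by field; rewrite !gt_eqF // addr_gt0.
by rewrite invr_ge0 mulr_ge0 ?sqr_ge0 // ltW.
Qed.

Lemma expected_drift_bounded : exists M : R, forall N,
  \sum_(k < N) \int[P]_w (drift (opinion k w) / k.+2%:R) <= M.
Proof.
have [C C0 step] := lyapunov_step symA gam_gt0 deg_gt0A.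
have [M VM] := lyapunov_ub symA gam_gt0 deg_gt0A.
pose V k w := lyapunov A gam (opinion k w).
pose q k w : R := drift (opinion k w) / k.+2%:R.
pose G i k w := lyapunov_grad A gam (opinion k w) i / k.+2%:R *
  ((psi k.+2 i w)%:R - Fmap A gam (opinion k w) i).
have intV k : P.-integrable setT (EFin \o V k).
  rewrite [X in _.-integrable _ X](_ : _ =
    EFin \o ((fun h => lyapunov A gam (opinion_of h)) \o history k)).
    exact/fin_integrable/history_measurable.
  by apply/funext => w; rewrite /V /= opinion_history.
have intq k : P.-integrable setT (EFin \o q k).
  rewrite [X in _.-integrable _ X](_ : _ =
    EFin \o ((fun h => drift (opinion_of h) / k.+2%:R) \o history k)).
    exact/fin_integrable/history_measurable.
  by apply/funext => w; rewrite /q /= opinion_history.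
pose Gs i k (u : {ffun 'I_k * 'I_n -> bool} * {ffun 'I_n -> bool}) :=
  lyapunov_grad A gam (opinion_of u.1) i / k.+2%:R *
  ((u.2 i)%:R - Fmap A gam (opinion_of u.1) i).
have GE i k w : G i k w = Gs i k (history k w, next_declaration k w).
  by rewrite /G /Gs /= opinion_history ffunE.
have intG k : P.-integrable setT (EFin \o (fun w => \sum_i G i k w)).
  rewrite [X in _.-integrable _ X](_ : _ = EFin \o ((fun u => \sum_i Gs i k u) \o
      (fun w => (history k w, next_declaration k w)))).
    exact/fin_integrable/next_measurable.
  by apply/funext => w /=; congr (_%:E); apply: eq_bigr => i _.
have EG k : \int[P]_w (\sum_i G i k w) = 0.
  under eq_Rintegral do under eq_bigr do rewrite GE.
  rewrite (fin_Rintegral P (@next_measurable k) (fun u => \sum_i Gs i k u)).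
  under eq_bigr do rewrite mulr_suml.
  rewrite exchange_big big1 //= => i _.
  rewrite -(fin_Rintegral P (@next_measurable k) (Gs i k)).
  under eq_Rintegral do rewrite -GE.
  pose phi (h : {ffun 'I_k * 'I_n -> bool}) := lyapunov_grad A gam (opinion_of h) i / k.+2%:R.
  rewrite -[RHS](martingale_increment phi i).
  by apply: eq_Rintegral => w _; rewrite /G /phi opinion_history.
(* The increment of opinion [i] is [F_i - b_i] plus the noise [psi - F_i], both over [k + 2]: the
   first part yields the drift [q], the second the mean-zero term [G]. *)
have ptw k w : V k w + q k w + \sum_i G i k w - C / k.+2%:R ^+ 2 <= V k.+1 w.
  have := step (opinion k w) (opinion k.+1 w) k.+2%:R^-1 (betaS_cube _ _)
    (betaS_cube _ _) (betaS_incr_le _ _).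
  rewrite exprVn -/(V k w) -/(V k.+1 w); apply: le_trans.
  rewrite lerD2r -addrA lerD2l /q /drift mulr_suml -big_split /=.
  apply: ler_sum => i _; rewrite betaS_incr -/(opinion k w).
  have := lyapunov_drift symA gam_gt0 deg_gt0A i (betaS_cube _ _ : cube (opinion k w)).
  have ik : 0 <= (k.+2%:R : R)^-1 by rewrite invr_ge0.
  move/(ler_wpM2r ik); rewrite /G /=.
  move: (deg A i / _ * _) (lyapunov_grad _ _ _ _) (psi _ _ _)%:R => a u y.
  by move: (Fmap _ _ _ _) (opinion _ _ _) _^-1 => F x z; lra.
have cst r : \int[P]_w r = r.
  rewrite Rintegral_cst // -[RHS]mulr1; congr (_ * _).
  exact: (congr1 fine (probability_setT P)).
have intD (f1 f2 : Omega -> R) : P.-integrable setT (EFin \o f1) ->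
    P.-integrable setT (EFin \o f2) ->
    P.-integrable setT (EFin \o (fun w => f1 w + f2 w)).
  by move=> i1 i2; exact: (integrableD measurableT i1 i2).
have intc r : P.-integrable setT (EFin \o (fun _ : Omega => r)).
  exact: finite_measure_integrable_cst.
have Estep k : \int[P]_w V k w + \int[P]_w q k w - C / k.+2%:R ^+ 2 <= \int[P]_w V k.+1 w.
  have intVq := intD _ _ (intV k) (intq k).
  have intVqG := intD _ _ intVq (intG k).
  have -> : \int[P]_w V k w + \int[P]_w q k w - C / k.+2%:R ^+ 2 =
      \int[P]_w (V k w + q k w + \sum_i G i k w + - (C / k.+2%:R ^+ 2)).
    rewrite (RintegralD measurableT intVqG (intc _)).
    rewrite (RintegralD measurableT intVq (intG k)).
    by rewrite (RintegralD measurableT (intV k) (intq k)) EG cst addr0.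
  apply: (le_Rintegral measurableT (intD _ _ intVqG (intc _)) (intV k.+1)) => w _.
  exact: ptw.
(* [M] bounds the expectation of [V N], and [C] the total second order error, by [sum_inv_sqr]. *)
exists (M - \int[P]_w V 0%N w + C) => N.
have sumE : \sum_(k < N) \int[P]_w q k w <=
    \int[P]_w V N w - \int[P]_w V 0%N w + C * \sum_(k < N) (k.+2%:R ^+ 2)^-1.
  elim: N => [|N IH]; first by rewrite !big_ord0 subrr mulr0 addr0.
  rewrite !big_ord_recr /= mulrDr; have := Estep N; move: IH.
  move: (C * _^-1) (C * \sum_(i < N) _) => x S; lra.
apply: (le_trans sumE); apply: lerD.
  rewrite lerD2r -[leRHS]cst.
  apply: (le_Rintegral measurableT (intV N) (intc M)) => w _.
  by apply: VM; exact: betaS_cube.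
by rewrite -[leRHS]mulr1 ler_wpM2l // sum_inv_sqr.
Qed.

(** By monotone convergence the series of nonnegative terms has a finite integral, hence is finite
    almost everywhere. *)
Lemma ae_drift_summable : {ae P, forall w, exists M : R, forall N,
  \sum_(k < N) drift (opinion k w) / k.+2%:R <= M}.
Proof.
have [M EM] := expected_drift_bounded.
pose q k w : R := drift (opinion k w) / k.+2%:R.
have q0 k w : 0 <= q k w by rewrite divr_ge0 ?drift_ge0.
have qE k : q k = (fun h => drift (opinion_of h) / k.+2%:R) \o history k.
  by apply/funext => w; rewrite /q /= opinion_history.
have intq k : P.-integrable setT (EFin \o q k).
  by rewrite qE; exact/fin_integrable/history_measurable.
pose S w := (\sum_(k <oo) (q k w)%:E)%E.
have S0 w : (0 <= S w)%E by apply: nneseries_ge0 => k _ _; rewrite lee_fin.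
have intS : P.-integrable setT S.
  apply/integrableP; split.
    apply: ge0_emeasurable_sum => k *; first by rewrite lee_fin.
    exact: (measurable_int P (intq k)).
  under eq_integral do rewrite gee0_abs //.
  rewrite /S integral_nneseries //; last 2 first.
  - by move=> k; exact: (measurable_int P (intq k)).
  - by move=> k w _; rewrite lee_fin.
  apply: le_lt_trans (ltry M); apply: lime_le.
    by apply: is_cvg_nneseries => k _ _; apply: integral_ge0 => w _;
      rewrite lee_fin; exact: q0.
  near=> N; rewrite big_mkord.
  rewrite (eq_bigr (fun k : 'I_N => (\int[P]_w q k w)%:E)).
    by rewrite sumEFin lee_fin; exact: EM.
  by move=> k _; rewrite /Rintegral fineK //;
    exact: (integrable_fin_num measurableT (intq k)).
have := integrable_ae measurableT intS; apply: filterS => w /(_ I) Sfin.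
exists (fine (S w)) => N; rewrite -lee_fin fineK // -sumEFin.
have := @nneseries_lim_ge R (fun k => (q k w)%:E) xpredT 0%N N.
by rewrite big_mkord; apply => k _ _; rewrite lee_fin.
Unshelve. all: by end_near. Qed.

Hypothesis conA : graph_connected A.

Lemma opinion_cvg w : ~ graph_bipartite A -> (exists i, gam i != 1) ->
  (exists M : R, forall N, \sum_(k < N) drift (opinion k w) / k.+2%:R <= M) ->
  exists2 c, cube c & (forall i, defect A gam c i = 0) /\
    forall i, (fun k => opinion k w i) @ \oo --> c i.
Proof.
move=> nbip gN1 [M sumM].
have [x fixx] := fixpoints_finite symA gam_gt0 deg_gt0A conA nbip gN1.
apply: (cvg_to_fix (b := fun k => opinion k w) _ _ _ fixx).
- by move=> k; exact: betaS_cube.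
- move=> i; pose kap := deg A i / (1 + gam i) ^+ 2.
  have kap0 : 0 < kap by rewrite divr_gt0 ?exprn_gt0 ?addr_gt0.
  (* The step constant comes from [defect_lip]; the sum bound holds because [drift] is at least
     [kap] times the squared defect at [i]. *)
  apply: (@slow_weighted_sqsum_cvg0 _ _ ((1 + gam i) * 2) (M / kap)) => [k|N].
    apply: defect_lip => //; [exact: betaS_cube|exact: betaS_cube|].
    by move=> j; exact: betaS_incr_le.
  rewrite ler_pdivlMr // mulr_suml; apply: le_trans (sumM N); apply: ler_sum => k _.
  rewrite mulrAC ler_wpM2r ?invr_ge0 // mulrC /drift (bigD1 i) //= lerDl.
  apply: sumr_ge0 => j _; rewrite mulr_ge0 ?sqr_ge0 // divr_ge0 ?sqr_ge0 //.
  exact: ltW.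
- move=> i; have h0 : (fun k => k.+2%:R^-1 : R) @ \oo --> (0 : R).
    by have := @cvg_harmonic R; rewrite -cvg_shiftS.
  apply/cvgr0Pnorm_lt => e e0; have /cvgr0Pnorm_lt/(_ e e0) := h0.
  apply: filterS => k; apply: le_lt_trans.
  by rewrite [leRHS]ger0_norm ?invr_ge0 //; exact: betaS_incr_le.
Qed.

End Process.

Theorem theorem2 (R : realType) (n : nat) (A : 'M[R]_n) (gam : 'I_n -> R)
  (b1 : 'I_n -> R)
  (d : measure_display) (Omega : measurableType d) (P : probability Omega R)
  (psi : nat -> 'I_n -> Omega -> bool) :
  symmetric_nonneg A -> graph_connected A -> ~ graph_bipartite A ->
  (forall i, 0 < gam i) -> (exists i, gam i != 1) ->
  (forall i, 0 < b1 i < 1) ->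
  (forall t i, measurable [set w | psi t i w]) ->
  (* law of the declarations: for every t >= 1, every history h of the
     declarations at times 2..t and every vector of declarations e at time t+1,
     P[H_t = h, psi_{t+1} = e] = P[H_t = h] * prod_i (p_i^{e_i} (1-p_i)^{1-e_i}),
     with p_i = F_i(beta(t)) evaluated along the history h *)
  (forall (t : nat) (h : nat -> 'I_n -> bool) (e : 'I_n -> bool), (1 <= t)%N ->
     let Ht := [set w | forall s i, (2 <= s <= t)%N -> psi s i w = h s i] in
     let bt := beta b1 h t in
     P (Ht `&` [set w | forall i, psi t.+1 i w = e i])
     = (P Ht * (\prod_i (if e i then Fmap A gam bt i else 1 - Fmap A gam bt i))%:E)%E) ->
  {ae P, forall w, exists bstar : 'I_n -> R,
      (forall i, 0 <= bstar i <= 1) /\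
      (forall i, Fmap A gam bstar i = bstar i) /\
      (forall i, (fun t => beta b1 (fun s j => psi s j w) t i) @ \oo --> bstar i)}.
Proof.
move=> symA conA nbip gam0 gN1 b01 mpsi law.
have deg0 := deg_gt0 symA conA nbip.
have := ae_drift_summable symA gam0 deg0 b01 mpsi law; apply: filterS => w sumw.
have [c cc [dc bc]] := opinion_cvg symA gam0 deg0 b01 conA nbip gN1 sumw.
exists c; split=> //; split=> i; first exact/(Fmap_fixE symA gam0 deg0 i cc).
(* [opinion k] is [beta] at time [k + 1], hence the shift. *)
by rewrite -cvg_shiftS; exact: bc.
Qed.
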